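(* Let $r\geq 2$ be an integer and let $\xi\in\{1,2,\dots,r\}$ be such that $$\xi^2\leq\xi+(r+1)\left\lfloor\frac{\xi^2}{r+1}\right\rfloor.$$ Let $s=r^2+r+\xi$ and $t=r^3+r^2+2\xi r+\left\lfloor\frac{\xi^2}{r+1}\right\rfloor$. Assume that $t$ and $s$ are coprime. Then $\mu\left(3;\frac{s}{t}\right)>t$, i.e. $\mu\left(3;\frac st\right)$ is bigger than the lower bound $\left\lceil \frac ts\left\lceil \frac ts\left\lceil \frac ts\right\rceil\right\rceil\right\rceil$.
   Context: For a positive integer $d$ and a real $\varepsilon\in(0,1)$, let $T^d=[\mathbb{R}/\mathbb{Z}]^d$ be the $d$-dimensional torus. An $\varepsilon$-sub-cube of $T^d$ is a set of the form $\{(x_1,\ldots,x_d): x_i\in[x_i^0,x_i^0+\varepsilon] \text{ for all } i\}$, where $x_1^0,\dots,x_d^0\in\mathbb{R}/\mathbb{Z}$ and $[x_i^0,x_i^0+\varepsilon]$ denotes the image in $\mathbb{R}/\mathbb{Z}$ of the corresponding closed real interval of length $\varepsilon$. $\mu(d;\varepsilon)$ denotes the minimum number of $\varepsilon$-sub-cubes whose union is $T^d$. *)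

(* Defs.v *)
From mathcomp Require Import all_boot all_order all_algebra.
From mathcomp Require Import generic_quotient ring_quotient.
From mathcomp Require Import boolp classical_sets reals set_interval.

Set Implicit Arguments.
Unset Strict Implicit.
Unset Printing Implicit Defensive.

Import Order.TTheory GRing.Theory Num.Theory.

Local Open Scope classical_set_scope.
Local Open Scope ring_scope.
Local Open Scope quotient_scope.

(* [Num.int_num_subdef] is the predicate underlying [Num.int], on which the
   library declares the additive subgroup structure. *)
Definition circle (R : realType) : Type :=
  Quotient.quot (Num.int_num_subdef : {pred R}).

Definition circle_proj (R : realType) (x : R) : circle R := \pi_(circle R) x.

Definition torus (R : realType) (d : nat) : Type := 'I_d -> circle R.

(* The base point is given by real representatives [a i] of its coordinates;
   the resulting set only depends on the classes of the [a i]. *)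
Definition subcube (R : realType) (d : nat) (eps : R) (a : 'I_d -> R) :
    set (torus R d) :=
  [set x | forall i, (@circle_proj R @` `[a i, a i + eps]) (x i)].

Definition covered_by (R : realType) (d : nat) (eps : R) (n : nat) : Prop :=
  exists a : 'I_n -> 'I_d -> R, \bigcup_j subcube eps (a j) = setT.

(* The default value 0 is never the size of a cover, since the torus is
   nonempty: [mu d eps] is 0 exactly when there is no finite cover. *)
Definition mu (R : realType) (d : nat) (eps : R) : nat :=
  xget 0%N [set n | covered_by d eps n /\
                    forall m, covered_by d eps m -> (n <= m)%N].

(* Main.v *)
Require Import Defs.
From mathcomp Require Import all_boot all_order all_algebra.
From mathcomp Require Import reals zify ring lra.

Set Implicit Arguments.
Unset Strict Implicit.
Unset Printing Implicit Defensive.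

Import Order.TTheory GRing.Theory Num.Theory.

Local Open Scope ring_scope.

(** Suppose that [t] cubes of side [s / t] cover the torus. A suitably shifted
    grid of [t ^ 3] points avoids all their faces, so each cube meets it in a
    discrete cube of side [s], and these cubes cover the discrete torus
    [(Z/t)^3] ([discretize]). What follows is a counting argument there.

    A line needs at least [r + 1] cubes because [r s < t], and a slice of [t]
    lines therefore needs at least [t (r + 1) / s], hence [s], cubes. The
    average over the slices is also [s], so every slice meets exactly [s] cubes
    ([card_slab]). Consequently, as the slice moves, exactly as many cubes enter
    as leave; since [s] generates [Z/t], it follows that the starting
    coordinates of the cubes along each axis are pairwise distinct
    ([start_inj]).

    The [s] cubes of a slice produce [s ^ 2 = t (r + 1) + e] incidences with its
    [t] lines, where [e] is the residue of [xi ^ 2] modulo [r + 1] and, by the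
    assumption on [xi], at most [xi]. So at most [e] lines of a slice meet more
    than [r + 1] cubes. If [p] leaves the moving slice as [q] enters it, then the
    lines through [p] but not through [q] had a cube to spare; hence whenever one
    coordinate grows by [s] from [p] to [q], the other two change by at most [e]
    ([step_near]).

    Take [r] such steps. One coordinate changes by [r s], that is by
    [-(t - r s)], and the others by at most [r e]. So the two cubes lie together
    on many lines, one of which meets exactly [r + 1] cubes. These cover the line
    only if any two of them start at least [t - r s = xi r + f] apart, with
    [f = floor (xi ^ 2 / (r + 1))] ([close_starts_far]). This contradicts
    [r e < xi r + f], which holds unless [xi = e = 1] and [f = 0]. In this last
    case all steps are [1] or [-1], the positions of the cubes form arithmetic
    progressions ([unit_steps]), and a comparison of two coordinates gives a
    contradiction ([no_box_cover]). *)

(** * Windows on a cycle *)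

Section Windows.
Local Open Scope nat_scope.
Variable n : nat.
Local Notation t := n.+2.
Local Notation G := 'I_n.+2.
Implicit Types (s : nat) (x y a : G).

Definition window s a : {set G} := [set x | (x - a)%R < s].

Lemma in_window s a x : (x \in window s a) = ((x - a)%R < s).
Proof. by rewrite inE. Qed.

(** Expanding the residues of sums and differences by cases, without [%%],
    turns every statement about windows into linear arithmetic. *)
Lemma val_addE x y :
  (x + y)%R = (if x + y < t then x + y else x + y - t) :> nat.
Proof.
rewrite /=; case: ltnP => h; first by rewrite modn_small.
have hx := ltn_ord x; have hy := ltn_ord y.
by rewrite -{1}(subnK h) modnDr modn_small //; lia.
Qed.

Lemma val_subE x y : (x - y)%R = (if y <= x then x - y else x + t - y) :> nat.
Proof.
have h := val_addE (x - y)%R y; rewrite subrK in h.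
have hx := ltn_ord x; have hy := ltn_ord y; have hd := ltn_ord (x - y)%R.
move: h; case: ifP; case: ifP; lia.
Qed.

Lemma val_natE k : k < t -> (k%:R : G)%R = k :> nat.
Proof. by move=> h; rewrite Zp_nat /= modn_small. Qed.

Lemma card_window s a : s <= t -> #|window s a| = s.
Proof.
move=> hs.
have -> : window s a = [set (a + widen_ord hs k)%R | k : 'I_s].
  apply/setP=> x; rewrite inE; apply/idP/imsetP => [h|[k _ ->]].
    exists (Ordinal h) => //; rewrite -[LHS](addrNK a) addrC; congr (_ + _)%R.
    exact/val_inj.
  by rewrite addrAC subrr add0r /=.
rewrite card_imset ?card_ord // => k1 k2 /addrI /(congr1 val) h; exact/val_inj.
Qed.

Lemma card_window_le s a : #|window s a| <= s.
Proof.
case: (leqP s t) => h; first by rewrite card_window.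
by apply: leq_trans (max_card _) _; rewrite card_ord ltnW.
Qed.

(** The distance of a residue to 0 along the cycle. *)
Definition cnorm x := minn x (t - x).

Lemma cnormN x : cnorm (- x)%R = cnorm x.
Proof.
rewrite -sub0r /cnorm val_subE; have hx := ltn_ord x.
by rewrite (_ : nat_of_ord (0%R : G) = 0) //; case: ifP; lia.
Qed.

Lemma cnormD x y : cnorm (x + y)%R <= cnorm x + cnorm y.
Proof.
rewrite /cnorm val_addE; have hx := ltn_ord x; have hy := ltn_ord y.
by case: ifP; lia.
Qed.

(** Two windows whose left ends are at distance [k] overlap in [s - k]
    consecutive points. *)
Lemma windows_meet s m a a' : m + cnorm (a' - a)%R <= s ->
  exists x0, window m x0 \subset window s a :&: window s a'.
Proof.
have hd := ltn_ord (a' - a)%R; rewrite /cnorm.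
case: (leqP (a' - a)%R (t - (a' - a)%R)) => hc h; [exists a' | exists a];
  apply/subsetP=> x; rewrite in_setI !in_window => hx0.
  have e1 : (x - a = (x - a') + (a' - a))%R by rewrite addrA subrK.
  have := val_addE (x - a')%R (a' - a)%R; rewrite -e1.
  by have hx := ltn_ord (x - a')%R; case: ifP; lia.
have e1 : (x - a' = (x - a) - (a' - a))%R by rewrite opprB addrA subrK.
have := val_subE (x - a)%R (a' - a)%R; rewrite -e1.
by have hx := ltn_ord (x - a)%R; case: ifP; lia.
Qed.

(** Two windows whose left ends are close together barely cover more than
    one. This is the loss that a line with no spare cube cannot afford. *)
Lemma windows_join s a a' : s < t ->
  exists x0,
    window s a :|: window s a' \subset window (s + cnorm (a' - a)%R) x0.
Proof.
move=> hs; have hd := ltn_ord (a' - a)%R; rewrite /cnorm.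
case: (leqP (a' - a)%R (t - (a' - a)%R)) => hc; [exists a | exists a'];
  apply/subsetP=> x; rewrite in_setU !in_window => hx0.
  have e1 : (x - a' = (x - a) - (a' - a))%R by rewrite opprB addrA subrK.
  have := val_subE (x - a)%R (a' - a)%R; rewrite -e1.
  by have hx := ltn_ord (x - a)%R; case: ifP; lia.
have e1 : (x - a = (x - a') + (a' - a))%R by rewrite addrA subrK.
have := val_addE (x - a')%R (a' - a)%R; rewrite -e1.
by have hx := ltn_ord (x - a')%R; case: ifP; lia.
Qed.

(** Moving a window by at least [m] uncovers [m] consecutive points. The bound
    [s + m <= t] prevents the moved window from wrapping around the cycle and
    covering them again from the other side. *)
Lemma windows_apart s m a a' : m <= s -> s + m <= t -> m <= cnorm (a' - a)%R ->
  exists x0, window m x0 \subset window s a :\: window s a'.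
Proof.
rewrite /cnorm => h1 h2 hm; have hd := ltn_ord (a' - a)%R.
(* If the moved window wraps around, it covers again the first
   s + (a' - a) - t points of the original one; the run starts after them. *)
pose k := s + (a' - a)%R - t.
have hk : (k%:R : G)%R = k :> nat by apply: val_natE; rewrite /k; lia.
exists (a + k%:R)%R; apply/subsetP=> x; rewrite in_setD !in_window => hx0.
have hu := ltn_ord (x - (a + k%:R))%R.
have := val_addE (x - (a + k%:R))%R k%:R%R.
have -> : (x - (a + k%:R) + k%:R = x - a)%R by rewrite opprD addrA subrK.
have := val_subE (x - a)%R (a' - a)%R.
have -> : (x - a - (a' - a) = x - a')%R by rewrite opprB addrA subrK.
have hkE : k = s + (a' - a)%R - t by [].
clearbody k; rewrite hk; case: ifP; case: ifP; lia.
Qed.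

Variable I : finType.
Implicit Types (B : {set I}) (f g : I -> G).

(** Double counting of the incidences between points and windows. *)
Lemma sum_card_window s B f : s <= t ->
  \sum_x #|[set j in B | x \in window s (f j)]| = #|B| * s.
Proof.
move=> hs; under eq_bigr => x _ do rewrite -sum1_card.
under eq_bigr => x _ do under eq_bigl => j do rewrite inE.
under eq_bigr => x _ do rewrite big_mkcondr /=.
rewrite exchange_big /= -sum_nat_const; apply: eq_bigr => j _.
by rewrite -big_mkcond sum1_card card_window.
Qed.

Lemma window_cover_bound s B f (Y : {set G}) : s <= t ->
  (forall y, y \in Y -> exists2 j, j \in B & y \in window s (f j)) ->
  #|Y| <= #|B| * s.
Proof.
move=> hs h; rewrite -(sum_card_window B f hs) -sum1_card.
rewrite [leqRHS](bigID (mem Y)) /= -[leqLHS]addn0; apply: leq_add => //.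
apply: leq_sum => y /h[j jB jy].
by rewrite card_gt0; apply/set0Pn; exists j; rewrite inE jB.
Qed.

(** Advancing the position [z] by one gains the windows that start at [z + 1]
    and loses those that end at [z]. *)
Lemma window_slide s B g z : s < t ->
  #|[set j in B | z \in window s (g j)]| + #|[set j in B | g j == (z + 1)%R]|
  = #|[set j in B | (z + 1)%R \in window s (g j)]|
    + #|[set j in B | (g j + s%:R)%R == (z + 1)%R]|.
Proof.
move=> hs; rewrite -[LHS]cardsUI -[RHS]cardsUI.
(* Both sides count the windows of length s + 1 around z + 1; everything
   is a condition on the offset d of z + 1 in the window of j. *)
have key (j : I) :
    [/\ (z \in window s (g j)) || (g j == (z + 1)%R) =
        ((z + 1)%R \in window s (g j)) || ((g j + s%:R)%R == (z + 1)%R),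
        (z \in window s (g j)) && (g j == (z + 1)%R) = false &
        ((z + 1)%R \in window s (g j)) && ((g j + s%:R)%R == (z + 1)%R)
          = false].
  rewrite !inE; set d := (z + 1 - g j)%R.
  have -> : (z - g j = d - 1)%R by rewrite /d addrAC addrK.
  have -> : (g j == z + 1)%R = (d == 0%R) by rewrite subr_eq0 eq_sym.
  have -> : (g j + s%:R == z + 1)%R = (d == s%:R%R).
    by rewrite /d subr_eq addrC eq_sym.
  rewrite -!(inj_eq (@ord_inj _)) val_subE val_natE //.
  have hd := ltn_ord d; move: (nat_of_ord d) hd => k hk.
  rewrite (_ : nat_of_ord (1%R : G) = 1) // (_ : nat_of_ord (0%R : G) = 0) //.
  by case: k hk => [|k] hk /=; split; apply/idP/idP; lia.
congr (_ + _).
  apply: eq_card => j; rewrite !inE -!andb_orr.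
  by case: (key j); rewrite !inE => ->.
apply: eq_card => j; rewrite !inE [LHS]andbACA [RHS]andbACA !andbb.
by case: (key j); rewrite !inE => _ -> ->.
Qed.
End Windows.

(** * Covers of the discrete three-dimensional torus *)

Section DiscreteCover.
Local Open Scope nat_scope.
Variables (n s r e : nat) (I : finType).
Local Notation t := n.+2.
Local Notation G := 'I_n.+2.
Implicit Types (a b c : I -> G) (x y z : G).

Definition box_cover a b c := forall x y z, exists j,
  [/\ x \in window s (a j), y \in window s (b j) & z \in window s (c j)].

Lemma box_cover_swap a b c : box_cover a b c -> box_cover b a c.
Proof. by move=> h x y z; have [j []] := h y x z; exists j. Qed.

Lemma box_cover_rot a b c : box_cover a b c -> box_cover b c a.
Proof. by move=> h x y z; have [j []] := h z x y; exists j. Qed.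

Definition slab a x : {set I} := [set j | x \in window s (a j)].

(** The cubes that meet a line parallel to the axis of the third coordinate
    [b], which does not occur in the definition. *)
Definition line a c x z : {set I} := [set j in slab a x | z \in window s (c j)].

Lemma lineC a c x z : line a c x z = line c a z x.
Proof. by apply/setP=> j; rewrite !inE andbC. Qed.

(** [e] is the spare capacity of a slice: the [s] squares that a slice meets
    contribute [s * s] incidences with its [t] lines, whereas the lines need
    only [t * r.+1]. All the rigidity comes from [e] being tiny. *)
Hypotheses (card_I : #|I| = t) (hcop : coprime t s) (hr : 2 <= r).
Hypotheses (hrs : r * s < t) (hts : t < r.+1 * s).
Hypotheses (hss : s * s = t * r.+1 + e) (he : r.+1 * e < s).

Lemma s_lt_t : s < t. Proof. by nia. Qed.
Lemma e_lt_s : e < s. Proof. by nia. Qed.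
Lemma se_lt_t : s + e.+1 <= t. Proof. by have := e_lt_s; nia. Qed.
Let hst := s_lt_t.
Let hstW := ltnW s_lt_t.
Let hes := e_lt_s.

Lemma line_cover a b c x z : box_cover a b c ->
  forall y, exists2 j, j \in line a c x z & y \in window s (b j).
Proof.
move=> h y; have [j [hx hy hz]] := h x y z.
by exists j; rewrite // !inE -!in_window hx.
Qed.

(** [r] windows have total length [r * s < t], too short to cover a line. *)
Lemma card_line a b c x z : box_cover a b c -> r < #|line a c x z|.
Proof.
move=> h; have := @window_cover_bound _ _ s (line a c x z) b [set: G] hstW
  (fun y _ => line_cover x z h y).
rewrite cardsT card_ord => hL; rewrite ltnNge; apply/negP => hL'.
have : #|line a c x z| * s <= r * s by rewrite leq_mul2r hL' orbT.
lia.
Qed.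

Lemma sum_line a c z : \sum_x #|line a c x z| = #|slab c z| * s.
Proof.
by rewrite -(sum_card_window _ a hstW); apply: eq_bigr => x _; rewrite lineC.
Qed.

Lemma card_slab_ge a b c z : box_cover a b c -> s <= #|slab c z|.
Proof.
move=> h; have : t * r.+1 <= #|slab c z| * s.
  rewrite -(sum_line a) -[X in X * _](card_ord t) -sum_nat_const.
  by apply: leq_sum => x _; apply: card_line h.
by move=> h1; nia.
Qed.

(** Every slice meets at least [s] cubes, and [s] is also the average over all
    slices, so there is no slack in any of them. *)
Lemma card_slab a b c z : box_cover a b c -> #|slab c z| = s.
Proof.
move=> h; apply/eqP; rewrite eqn_leq (card_slab_ge _ h) andbT.
have h1 : \sum_z #|slab c z| = t * s.
  have := sum_card_window [set: I] c hstW; rewrite cardsT card_I => <-.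
  by apply: eq_bigr => x _; apply: eq_card => j; rewrite !inE.
have h2 : \sum_(z' : G) s = t * s by rewrite sum_nat_const card_ord.
rewrite (bigD1 z) //= in h1; rewrite (bigD1 z) //= in h2.
rewrite -(leq_add2r (\sum_(i : G | i != z) s)) h2 -h1 leq_add2l.
by apply: leq_sum => x _; apply: card_slab_ge h.
Qed.

(** As consecutive slices meet equally many cubes, one cube starts for each
    cube that ends, that is, that started [s] steps before. *)
Lemma fiber_shift a b c x : box_cover a b c ->
  #|[set j | c j == (x + s%:R)%R]| = #|[set j | c j == x]|.
Proof.
move=> h; have := window_slide [set: I] c (x + s%:R - 1)%R hst; rewrite subrK.
have e1 z : #|[set j in [set: I] | z \in window s (c j)]| = s.
  by rewrite -[RHS](card_slab z h); apply: eq_card => j; rewrite !inE.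
rewrite !e1 => /addnI; rewrite (eq_card (B := [set j | c j == (x + s%:R)%R])).
  move=> ->; apply: eq_card => j; rewrite !inE /=; exact: (inj_eq (addIr _)).
by move=> j; rewrite !inE.
Qed.

Lemma s_mod_unit : (s%:R : G)%R \is a GRing.unit.
Proof. by rewrite (@unitZpE t). Qed.

(** The number of cubes with a given starting coordinate is invariant under
    translation by [s], which generates the cycle; so it is constant, and its
    mean is 1. *)
Lemma start_inj a b c : box_cover a b c -> injective c.
Proof.
move=> h; pose m x := #|[set j | c j == x]|.
have mS k : m (s%:R *+ k)%R = m 0%R.
  by elim: k => // k IH; rewrite mulrSr /m (fiber_shift _ h).
have m0 x : m x = m 0%R.
  by rewrite -(mS (s%:R^-1 * x)%R) -mulr_natr natr_Zp mulVKr // s_mod_unit.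
have : \sum_x m x = t.
  rewrite -[RHS]card_I -sum1_card (partition_big c xpredT) //=.
  apply: eq_bigr => x _; rewrite /m -sum1_card.
  by apply: eq_bigl => j; rewrite inE.
under eq_bigr => x _ do rewrite m0.
rewrite sum_nat_const card_ord => hm.
have m1 x : m x = 1 by rewrite m0; nia.
move=> i j hij; have /eqP/cards1P[k hk] := m1 (c i).
have : i \in [set k] by rewrite -hk inE.
have : j \in [set k] by rewrite -hk inE hij.
by rewrite !inE => /eqP -> /eqP.
Qed.

Lemma start_surj a b c : box_cover a b c -> forall x, exists j, c j = x.
Proof.
move=> h x; have hI : #|G| <= #|I| by rewrite card_ord card_I.
have /(_ x)/codomP[j ->] : forall y, y \in codom c.
  by move=> y; apply/inj_card_onto => //; apply: start_inj h.
by exists j.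
Qed.

(** The lines of a slice share a spare capacity of [e], so at most [e] of them
    meet more cubes than the necessary [r.+1]. *)
Lemma excess_bound a b c z (X : {set G}) : box_cover a b c ->
  (forall x, x \in X -> r.+1 < #|line a c x z|) -> #|X| <= e.
Proof.
move=> h hX; have := sum_line a c z; rewrite (card_slab z h) hss => hS.
rewrite -(leq_add2l (t * r.+1)) -hS -[X in X * _](card_ord t) -sum_nat_const.
rewrite -sum1_card [X in _ + X]big_mkcond -big_split /=.
apply: leq_sum => x _; case: ifP => [/hX|_]; first by rewrite addn1.
by rewrite addn0; apply: card_line h.
Qed.

(** When the slice moves on, cube [p] is replaced by cube [q] and nothing else
    changes. The lines through [p] that miss [q] lose one cube, so they must
    have had a spare one; by [excess_bound] they are few, which forces [q] to
    start near [p] in the other coordinates. *)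
Lemma step_near a b c p q : box_cover a b c -> c q = (c p + s%:R)%R ->
  cnorm (a q - a p)%R <= e.
Proof.
move=> h hpq; rewrite leqNgt; apply/negP => hn.
(* A long move would uncover e + 1 lines of the slice just before c q. *)
have [x0 hx0] := windows_apart hes se_lt_t hn.
suff : #|window e.+1 x0| <= e.
  by rewrite card_window ?ltnn //; have := se_lt_t; lia.
apply: (@excess_bound a b c (c q - 1)%R) => // x /(subsetP hx0).
rewrite in_setD => /andP[nq hp].
have := window_slide (slab a x) c (c q - 1)%R hst.
rewrite subrK -/(line a c x _).
have -> : [set j in slab a x | c j == c q] = set0.
  apply/setP => j; rewrite inE [RHS]inE; apply/negP => /andP[hj /eqP hjq].
  by move: hj; rewrite (start_inj h hjq) inE (negPf nq).
rewrite cards0 addn0 => ->; rewrite -addn1.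
apply: leq_add; first exact: card_line h.
by rewrite card_gt0; apply/set0Pn; exists p; rewrite !inE -in_window hp hpq /=.
Qed.

Lemma chain a b c p k : box_cover a b c -> exists q,
  [/\ c q = (c p + (k * s)%:R)%R, cnorm (a q - a p)%R <= k * e
    & cnorm (b q - b p)%R <= k * e].
Proof.
move=> h; elim: k => [|k [q [cq aq bq]]].
  by exists p; rewrite !subrr mul0n addr0; split.
have [q' cq'] := start_surj h (c q + s%:R)%R; exists q'; split.
- by rewrite cq' cq mulSn addnC natrD addrA.
- have -> : (a q' - a p = (a q' - a q) + (a q - a p))%R by rewrite addrA subrK.
  apply: leq_trans (cnormD _ _) _; rewrite mulSn; apply: leq_add => //.
  exact: step_near h cq'.
- have -> : (b q' - b p = (b q' - b q) + (b q - b p))%R by rewrite addrA subrK.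
  apply: leq_trans (cnormD _ _) _; rewrite mulSn; apply: leq_add => //.
  exact: step_near (box_cover_swap h) cq'.
Qed.

(** If two cubes both meet many lines of a common slice, then one of these
    lines has no spare cube. The [r.+1] windows on it cover the cycle, so the
    two given ones cannot overlap much: [r] windows leave [t - r * s] points
    uncovered. *)
Lemma close_starts_far a b c p q : box_cover a b c -> p != q ->
  (c p - c q)%R < s -> cnorm (a q - a p)%R + e < s ->
  t <= r * s + cnorm (b q - b p)%R.
Proof.
move=> h hpq hc ha; rewrite addnC -addnS in ha.
have [x0 hx0] : exists x0,
    window e.+1 x0 \subset window s (a p) :&: window s (a q).
  by apply: windows_meet; lia.
pose z := c p.
have [x xX hx] : exists2 x, x \in window e.+1 x0 & #|line a c x z| <= r.+1.
  have /negP : ~~ (#|window e.+1 x0| <= e).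
    by rewrite card_window ?ltnn //; have := se_lt_t; lia.
  move=> hX; apply/exists_inP; rewrite -[X in is_true X]negbK.
  apply/negP => /exists_inPn hX'; apply: hX.
  by apply: (excess_bound h (z := z)) => x /hX'; rewrite -ltnNge.
have /(subsetP hx0) := xX; rewrite in_setI => /andP[xp xq].
have pL : p \in line a c x z by rewrite !inE -in_window xp /z subrr /=; lia.
have qL : q \in line a c x z by rewrite !inE -in_window xq.
set L := line a c x z in hx pL qL.
have [y0 hy0] := windows_join (b p) (b q) hst.
have hY : #|~: window (s + cnorm (b q - b p)%R) y0| <= #|L :\ p :\ q| * s.
  apply: (@window_cover_bound _ _ s _ b) => // y; rewrite in_setC => hy.
  have [j jL yj] := line_cover x z h y; exists j => //.
  rewrite !in_setD1 jL andbT; apply/andP; split; apply/eqP => ej; move/negP: hy;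
    by apply; apply: (subsetP hy0); rewrite in_setU -ej yj ?orbT.
have hL : #|L :\ p :\ q| <= r.-1.
  move: hx; rewrite (cardsD1 p L) (cardsD1 q (L :\ p)) in_setD1 eq_sym.
  rewrite hpq pL qL.
  by rewrite !add1n; lia.
rewrite -[leqLHS](card_ord t) -(cardsC (window (s + cnorm (b q - b p)%R) y0)).
have {}hY := leq_trans hY (leq_mul hL (leqnn s)).
apply: leq_trans (leq_add (card_window_le _ _) hY) _.
by rewrite -[in r * s](prednK (ltnW hr)) mulSn; lia.
Qed.

Lemma cnorm_le1 (g : G) : cnorm g <= 1 -> g != 0%R -> g = 1%R \/ g = (- 1)%R.
Proof.
rewrite /cnorm -(inj_eq (@ord_inj _)) => h1 /= g0; have hg := ltn_ord g.
have [g1|g1] : nat_of_ord g = 1 \/ nat_of_ord g = n.+1 by lia.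
  by left; apply: ord_inj; rewrite g1.
right; apply: ord_inj; rewrite -sub0r val_subE g1.
by rewrite (_ : nat_of_ord (0 : G)%R = 0).
Qed.

(** For [e = 1] the steps of [step_near] are [1] or [-1], nonzero because the
    coordinates are injective. A change of sign would lead back to a cube that
    was already visited, so all the steps along a coordinate are equal. *)
Lemma unit_steps a b c p : e = 1 -> box_cover a b c ->
  exists2 u : G, u = 1%R \/ u = (- 1)%R &
  forall k j, c j = (c p + (k * s)%:R)%R -> a j = (a p + u *+ k)%R.
Proof.
move=> e1 h; have ia := start_inj (box_cover_rot h).
have ic := start_inj h.
have unit_diff q q' : c q' = (c q + s%:R)%R ->
    (a q' - a q)%R = 1%R \/ (a q' - a q)%R = (- 1)%R.
  move=> hq; apply: cnorm_le1; first by rewrite -e1; apply: step_near h hq.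
  rewrite subr_eq0; apply/eqP => /ia ej; move: hq; rewrite ej -[LHS]addr0.
  by move=> /addrI /(congr1 (@nat_of_ord _)); rewrite val_natE //=; lia.
have [p1 hp1] := start_surj h (c p + s%:R)%R.
exists (a p1 - a p)%R; first exact: unit_diff.
set u := (a p1 - a p)%R.
suff H k : forall j j', c j = (c p + (k * s)%:R)%R -> c j' = (c j + s%:R)%R ->
    a j = (a p + u *+ k)%R /\ (a j' - a j)%R = u.
  move=> k j hj; have [j' hj'] := start_surj h (c j + s%:R)%R.
  by have [] := H k j j' hj hj'.
elim: k => [|k IH] j j' hj hj'.
  have ej : j = p by apply: ic; rewrite hj mul0n addr0.
  have ej' : j' = p1 by apply: ic; rewrite hj' hp1 ej.
  by rewrite ej ej' mulr0n addr0.
have [i hi] := start_surj h (c p + (k * s)%:R)%R.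
have hij : c j = (c i + s%:R)%R by rewrite hj hi mulSn addnC natrD addrA.
have [ai aij] := IH i j hi hij; split.
  by rewrite mulrSr addrA -ai -aij addrC subrK.
(* A reversal of direction would lead back to a i, hence to cube i itself. *)
have back : (a j' - a j)%R != (- u)%R.
  apply/eqP => hb; have /ia ej : a j' = a i.
    by rewrite -[a j'](subrK (a j)) hb -aij opprB subrK.
  move: hj'; rewrite ej hij -addrA -[LHS]addr0 => /addrI.
  rewrite -natrD => /(congr1 (@nat_of_ord _)).
  by rewrite val_natE /=; nia.
have := unit_diff _ _ hj'; have := unit_diff _ _ hp1; rewrite -/u.
by case=> eu [] ej; move: back; rewrite eu ej ?opprK ?eqxx.
Qed.

(** After [r] steps by [s] the third coordinate has nearly returned: it has
    moved by [r * s - t], a shift shorter than a window, while the other two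
    have moved by at most [r * e]. Then [close_starts_far] requires
    [t - r * s <= r * e]. This excludes everything but [e = 1], where the
    progressions are explicit: after [s] steps the first two coordinates have
    both moved by exactly [s] up to sign, whereas a move by [s] in one
    coordinate must come with a move by at most 1 in the other. *)
Theorem no_box_cover a b c : r * e < t - r * s \/ e = 1 -> ~ box_cover a b c.
Proof.
move=> hre h; have /card_gt0P[p _] : 0 < #|I| by rewrite card_I.
case: hre => [hre | e1].
  have [q [cq aq bq]] := chain p r h.
  have hcc : (c p - c q)%R = t - r * s :> nat.
    rewrite cq opprD addrA subrr val_subE val_natE //.
    rewrite (_ : nat_of_ord (0 : G)%R = 0) // leqn0.
    by case: ifP => [/eqP|]; nia.
  have hpq : p != q.
    by apply/eqP => ej; move: hcc; rewrite ej subrr /=; lia.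
  have : t <= r * s + cnorm (b q - b p)%R.
    by apply: close_starts_far h hpq _ _; [rewrite hcc; nia | nia].
  lia.
have [u hu au] := unit_steps p e1 h.
have [v hv bv] := unit_steps p e1 (box_cover_swap h).
have [q cq] := start_surj h (c p + (s * s)%:R)%R.
have ns : cnorm (b q - b p)%R > 1.
  rewrite (bv _ _ cq) addrAC subrr add0r.
  have -> : cnorm (v *+ s)%R = cnorm (s%:R : G)%R.
    by case: hv => ->; rewrite // mulNrn cnormN.
  by rewrite /cnorm val_natE //; nia.
suff : cnorm (b q - b p)%R <= e by rewrite e1 leqNgt ns.
case: hu (au _ _ cq) => -> hq.
  exact: step_near (box_cover_rot h) hq.
rewrite -cnormN opprB; apply: step_near (box_cover_rot h) _.
by rewrite hq mulNrn subrK.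
Qed.
End DiscreteCover.

(** * From the real torus to the discrete one *)

From mathcomp Require Import generic_quotient ring_quotient.
From mathcomp Require Import boolp classical_sets.

Section Torus.
Local Open Scope classical_set_scope.
Variable R : realType.

Lemma circle_proj_eq (x y : R) :
  circle_proj x = circle_proj y <-> exists m : int, x = y + m%:~R.
Proof.
rewrite /circle_proj; split=> [/eqP|[m ->]].
  rewrite -Quotient.idealrBE => /intrP[m hm]; exists m.
  by rewrite -hm addrC subrK.
apply/eqP; rewrite -Quotient.idealrBE addrAC subrr add0r.
by apply/intrP; exists m.
Qed.

Lemma circle_projP (z : circle R) : exists x : R, circle_proj x = z.
Proof. by exists (repr z); rewrite /circle_proj reprK. Qed.

(** Extra cubes are chosen as copies of one that is already there; it exists
    because the torus is not empty. *)
Lemma covered_by_mono d (eps : R) m n :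
  (m <= n)%N -> covered_by d eps m -> covered_by d eps n.
Proof.
move=> hmn [a ha]; have H (x : torus R d) : exists j, subcube eps (a j) x.
  by have : [set: torus R d] x by []; rewrite -ha => -[j _]; exists j.
have [j0 _] := H (fun=> circle_proj 0).
have hm : (0 < m)%N by apply: leq_ltn_trans (ltn_ord j0).
exists (fun j : 'I_n => a (insubd j0 (val j))); apply/seteqP; split=> // x _.
have [j jx] := H x; exists (widen_ord hmn j) => //=.
rewrite (_ : insubd j0 _ = j) //.
by apply: val_inj; rewrite val_insubd /= ltn_ord.
Qed.

(** A finite cover is needed to exclude the default value of [mu]. The cubes
    starting at the points of a grid of mesh at most [eps] form one. *)
Lemma covered_by_ex d (eps : R) : 0 < eps -> exists n, covered_by d eps n.
Proof.
move=> e0; have [N hN] : exists N, 1 <= N.+1%:R * eps.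
  exists (Num.bound eps^-1); rewrite -ler_pdivrMr // mul1r.
  apply: le_trans (ltW (archi_boundP _)) _; first by rewrite invr_ge0 ltW.
  by rewrite ler_nat.
have N0 : 0 < N.+1%:R :> R by rewrite ltr0n.
pose T := {ffun 'I_d -> 'I_N.+1}.
exists #|T|, (fun j i => (val ((enum_val j : T) i))%:R / N.+1%:R).
apply/seteqP; split=> // x _.
have H i : exists k : 'I_N.+1,
    (@circle_proj R @` `[(val k)%:R / N.+1%:R,
                         (val k)%:R / N.+1%:R + eps]) (x i).
  have [y hy] := circle_projP (x i); pose F := Num.floor (N.+1%:R * y).
  pose q := (F %/ N.+1)%Z.
  have hk : (`|(F %% N.+1)%Z| < N.+1)%N by lia.
  exists (Ordinal hk); exists (y - q%:~R); last first.
    by rewrite -hy; apply/circle_proj_eq; exists (- q); rewrite rmorphN.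
  have /andP[h1 h2] := floor_itv (N.+1%:R * y); rewrite -/F intrD in h1 h2.
  have -> : (val (Ordinal hk))%:R = F%:~R - q%:~R * N.+1%:R :> R.
    rewrite [RHS](_ : _ = (F - q * N.+1%:Z)%:~R); last first.
      by rewrite intrB intrM -!pmulrn.
    by rewrite pmulrn; congr (_ %:~R); rewrite /= /q; lia.
  rewrite /= in_itv /=; apply/andP; split; rewrite -(ler_pM2l N0).
    by rewrite mulrCA mulfV ?gt_eqF // mulr1 mulrBr [_ * q%:~R]mulrC; lra.
  rewrite mulrBr mulrDr [_ * (_ / _)]mulrC divfK ?gt_eqF // [_ * q%:~R]mulrC.
  lra.
have [k hk] := choice H.
exists (enum_rank ([ffun i => k i] : T)) => //= i.
by rewrite enum_rankK ffunE; apply: hk.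
Qed.

Lemma mu_gt d (eps : R) n : 0 < eps -> ~ covered_by d eps n -> (n < mu d eps)%N.
Proof.
move=> e0 hn; rewrite ltnNge; apply/negP => hle; apply: hn.
apply: covered_by_mono hle _.
have [N hN] := covered_by_ex d e0.
suff /(xgetPex 0%N)[] : exists m, [set m | covered_by d eps m /\
    forall k, covered_by d eps k -> (m <= k)%N] m by [].
have ex : exists m, `[< covered_by d eps m >] by exists N; apply/asboolP.
case: (ex_minnP ex) => m /asboolP hm hmin; exists m; split=> // k hk.
by apply: hmin; apply/asboolP.
Qed.

(** Used for the fractional parts of the base points, to shift the grid so
    that it avoids the faces of all the cubes. *)
Lemma uniform_bound_lt1 (J : finType) (g : J -> R) : (forall j, g j < 1) ->
  exists2 th, th < 1 & forall j, g j < th.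
Proof.
move=> h; pose M := \big[Num.max/0]_j g j.
have M1 : M < 1 by apply: bigmax_lt.
exists ((M + 1) / 2) => [|j]; first lra.
have : g j <= M by apply: le_bigmax.
lra.
Qed.

(** The grid [(k + th) / t], with [th < 1] above the fractional parts of all
    the [t * a j i], meets each side [[a j i, a j i + s / t]] in exactly [s] points,
    the first one having [k = floor (t * a j i)]. For a badly chosen grid, a
    side could contain [s + 1] points since it is closed at both ends. *)
Lemma discretize d n s m : covered_by d (s%:R / n.+2%:R : R) m ->
  exists f : 'I_m -> 'I_d -> 'I_n.+2, forall x : 'I_d -> 'I_n.+2,
  exists j, forall i, x i \in window s (f j i).
Proof.
move=> [a ha]; set t := n.+2; have t0 : 0 < t%:R :> R by rewrite ltr0n.
pose F j i := Num.floor (t%:R * a j i).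
pose g (ji : 'I_m * 'I_d) := t%:R * a ji.1 ji.2 - (F ji.1 ji.2)%:~R.
have [th th1 hth] : exists2 th, th < 1 & forall ji, g ji < th.
  apply: uniform_bound_lt1 => -[j i]; rewrite /g /= ltrBlDl.
  by have /andP[_] := floor_itv (t%:R * a j i); rewrite intrD addrC.
exists (fun j i => (F j i)%:~R) => x.
pose pt : torus R d := fun i => circle_proj ((val (x i))%:R / t%:R + th / t%:R).
have : [set: torus R d] pt by [].
rewrite -ha => -[j _ hj]; exists j => i.
have [y /= yI /circle_proj_eq[k yk]] := hj i.
move: yI; rewrite in_itv /= yk => /andP[h1 h2].
have hg := hth (j, i); rewrite /g /= in hg.
have /andP[hF _] := floor_itv (t%:R * a j i); rewrite -/(F j i) in hF.
(* The offset of the grid point in its window, for the lift of the residue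
   x i that falls into the real interval. *)
pose w : int := (val (x i))%:Z + k * t%:Z - F j i.
have wE : w%:~R = (val (x i))%:R + k%:~R * t%:R - (F j i)%:~R :> R.
  by rewrite /w intrB intrD intrM !pmulrn.
have e1 : t%:R * ((val (x i))%:R / t%:R + th / t%:R + k%:~R) =
    (val (x i))%:R + th + k%:~R * t%:R :> R.
  by rewrite [LHS]mulrC !mulrDl !divfK ?gt_eqF.
have {}h1 : t%:R * a j i <= (val (x i))%:R + th + k%:~R * t%:R.
  by rewrite -e1 ler_pM2l.
have {}h2 : (val (x i))%:R + th + k%:~R * t%:R <= t%:R * a j i + s%:R.
  rewrite -e1; apply: le_trans (_ : t%:R * (a j i + s%:R / t%:R) <= _).
    by rewrite ler_pM2l.
  by rewrite mulrDr [t%:R * (_ / _)]mulrC divfK ?gt_eqF.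
have w0 : 0 <= w by rewrite -ltzD1 -(ltr_int R) intrD wE; lra.
have ws : w < s%:Z by rewrite -(ltr_int R) wE -pmulrn; lra.
rewrite in_window.
have -> : x i - (F j i)%:~R = `|w|%N%:R.
  rewrite pmulrn gez0_abs // /w intrB intrD intrM -!pmulrn natr_Zp.
  by rewrite (@pchar_Zp t) ?mulr0 ?addr0.
rewrite Zp_nat /= (leq_ltn_trans (leq_mod _ _)) //; lia.
Qed.
End Torus.

(** * The parameters *)

(** Expanding gives [s ^ 2 - t * r.+1 = xi ^ 2 - r.+1 * f], which for
    [f = xi ^ 2 %/ r.+1] is the residue of [xi ^ 2] modulo [r.+1]; call it [e].
    The assumption on [xi] says [e <= xi], so [r * e <= xi * r + f = t - r * s],
    and equality requires [f = 0] and [xi ^ 2 = xi]. *)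
Lemma parameter_bounds (r xi f s t : nat) :
  (2 <= r)%N -> (1 <= xi <= r)%N ->
  (r.+1 * f <= xi ^ 2)%N -> (xi ^ 2 <= xi + r.+1 * f)%N ->
  s = (r ^ 2 + r + xi)%N -> t = (r ^ 3 + r ^ 2 + 2 * xi * r + f)%N ->
  [/\ (r * s < t)%N, (t < r.+1 * s)%N & exists e,
    [/\ (s * s = t * r.+1 + e)%N, (r.+1 * e < s)%N &
        (r * e < t - r * s)%N \/ e = 1%N]].
Proof.
move=> hr /andP[xi1 xir] hf1 hf2 hs ht.
have fxi : (f < xi)%N by rewrite -(ltn_pmul2l (ltn0Sn r)); nia.
have ts : t = (r * s + (xi * r + f))%N by rewrite ht hs; ring.
split; [nia | nia | exists (xi ^ 2 - r.+1 * f)%N].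
set e := (xi ^ 2 - r.+1 * f)%N.
have xie : (xi ^ 2 = r.+1 * f + e)%N by rewrite subnKC.
have exi : (e <= xi)%N by rewrite /e leq_subLR addnC.
clearbody e; split.
- have : (s * s + r.+1 * f = t * r.+1 + xi ^ 2)%N by rewrite ht hs; ring.
  lia.
- nia.
- rewrite ts addKn; move: exi; rewrite leq_eqVlt => /orP[/eqP exi|exi].
    have [f0|f0] := posnP f; last by left; nia.
    by right; move: xie; rewrite f0 muln0 add0n exi; nia.
  by left; nia.
Qed.

Lemma ceil_iterate_le (R : realType) (r s t : nat) (q : R) : (0 < s)%N ->
  (t <= r.+1 * s)%N -> (t * r.+1 <= s * s)%N -> q = t%:R / s%:R ->
  Num.ceil (q * (Num.ceil (q * (Num.ceil q)%:~R))%:~R) <= t%:Z.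
Proof.
move=> s0 h1 h2 qE; have s0R : 0 < s%:R :> R by rewrite ltr0n.
have q0 : 0 <= q by rewrite qE divr_ge0.
have c1 : Num.ceil q <= r.+1%:Z.
  by rewrite ceil_le_int -pmulrn qE ler_pdivrMr // -natrM ler_nat.
have c2 : Num.ceil (q * (Num.ceil q)%:~R) <= s%:Z.
  rewrite ceil_le_int; apply: le_trans (_ : q * r.+1%:Z%:~R <= _).
    by rewrite ler_wpM2l // ler_int.
  by rewrite -!pmulrn qE mulrAC ler_pdivrMr // -!natrM ler_nat.
rewrite ceil_le_int; apply: le_trans (_ : q * s%:Z%:~R <= _).
  by rewrite ler_wpM2l // ler_int.
by rewrite -!pmulrn qE divfK // gt_eqF.
Qed.

Theorem theorem3 (R : realType) (r xi s t : nat)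
    (hr : (2 <= r)%N)
    (hxi : (1 <= xi <= r)%N)
    (hxi2 : (xi ^ 2 <= xi + r.+1 * (xi ^ 2 %/ r.+1))%N)
    (hs : s = (r ^ 2 + r + xi)%N)
    (ht : t = (r ^ 3 + r ^ 2 + 2 * xi * r + xi ^ 2 %/ r.+1)%N)
    (hst : coprime t s) :
  let q : R := t%:R / s%:R in
  (t < mu 3 (s%:R / t%:R : R))%N /\
  Num.ceil (q * (Num.ceil (q * (Num.ceil q)%:~R))%:~R)
    < (mu 3 (s%:R / t%:R : R))%:Z.
Proof.
move=> q.
have hf : (r.+1 * (xi ^ 2 %/ r.+1) <= xi ^ 2)%N by rewrite mulnC leq_divM.
have [rst trs [e [hss hes hre]]] := parameter_bounds hr hxi hf hxi2 hs ht.
have s0 : (0 < s)%N by lia.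
have t2 : (2 <= t)%N.
  by apply: leq_ltn_trans rst; rewrite muln_gt0 s0 (ltnW hr).
suff H : (t < mu 3 (s%:R / t%:R : R))%N.
  split=> //; apply: (@le_lt_trans _ _ t%:Z) => //.
  by apply: (@ceil_iterate_le R r s) => //; lia.
apply: mu_gt; first by rewrite divr_gt0 // ltr0n //; lia.
case: t t2 {ht q hxi2} hst rst trs hss hre => [//|[//|n]] _ hst rst trs hss hre.
move=> /discretize[g hg].
apply: (@no_box_cover n s r e 'I_n.+2 (card_ord _) hst hr rst trs hss hes
  (g^~ ord0) (g^~ (inord 1)) (g^~ (inord 2)) hre) => x y z.
have [j hj] := hg (fun i => nth x [:: x; y; z] i); exists j; split.
- exact: hj ord0.
- by have := hj (inord 1); rewrite inordK.
- by have := hj (inord 2); rewrite inordK.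
Qed.
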